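(* Fix $\epsilon\in(0,1)$ and let $N=N(n)>n$ be a sequence of positive integers. For each $n$, let $X_1,\ldots,X_N$ be independent random points uniformly distributed on $S^{n-1}$ and set $S_{N,n}:=\mathrm{conv}\{X_1,\ldots,X_N\}$. Then $$\lim_{n\to\infty}\frac{\mathbb{E}\,V_n(S_{N,n})}{V_n(B_2^n)}=\begin{cases}0 & \text{if } N\le \exp\left((1-\epsilon)\left(\frac{n-1}{2}\right)\log n\right)\text{ for all sufficiently large } n,\\ 1 & \text{if } N\ge \exp\left((1+\epsilon)\left(\frac{n-1}{2}\right)\log n\right)\text{ for all sufficiently large } n.\end{cases}$$
   Context: $B_2^n$ is the closed Euclidean unit ball in $\mathbb{R}^n$, $S^{n-1}$ is the Euclidean unit sphere in $\mathbb{R}^n$ (with its rotationally invariant probability measure as uniform distribution), and $V_n$ is $n$-dimensional Lebesgue measure. *)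

(* Defs.v *)
From HB Require Import structures.
From mathcomp Require Import all_boot all_order all_algebra.
From mathcomp Require Import all_classical all_reals all_analysis.

Set Implicit Arguments.
Unset Strict Implicit.
Unset Printing Implicit Defensive.

Import Order.TTheory GRing.Theory Num.Theory.
Import numFieldNormedType.Exports.

Local Open Scope classical_set_scope.
Local Open Scope ring_scope.

Definition rV_display : measure_display.
Proof. exact. Qed.

(* The product sigma-algebra of the Borel sets of R; as R is second countable,
   these are the Borel sets of R^n. *)
Section measurable_rV.
Context {R : realType} {n : nat}.

Definition measurable_rV : set (set 'rV[R]_n) :=
  g_sigma_preimage (fun (i : 'I_n) (v : 'rV[R]_n) => v ord0 i).

Let measurable_rV0 : measurable_rV set0.
Proof. exact: sigma_algebra0. Qed.

Let measurable_rVC A : measurable_rV A -> measurable_rV (~` A).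
Proof. exact: sigma_algebraC. Qed.

Let measurable_rV_bigcup (F : (set 'rV[R]_n)^nat) :
  (forall i, measurable_rV (F i)) -> measurable_rV (\bigcup_i F i).
Proof. exact: sigma_algebra_bigcup. Qed.

HB.instance Definition _ := @isMeasurable.Build rV_display 'rV[R]_n
  measurable_rV measurable_rV0 measurable_rVC measurable_rV_bigcup.

End measurable_rV.

Lemma measurable_coord (R : realType) n (i : 'I_n) :
  measurable_fun [set: 'rV[R]_n] (fun v => v ord0 i).
Proof.
move=> _ Y mY; rewrite setTI; apply: sub_sigma_algebra => /=.
rewrite -bigcup_seq/=; exists i => /=; first by rewrite mem_index_enum.
by exists Y => //; rewrite setTI.
Qed.

Lemma measurable_fun_rVP d (T : measurableType d) (R : realType) n
    (f : T -> 'rV[R]_n) :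
  measurable_fun [set: T] f <->
  forall i, measurable_fun [set: T] (fun t => f t ord0 i).
Proof.
split=> [mf i|mf].
  exact: (measurableT_comp (measurable_coord i) mf).
move=> _ A; rewrite setTI; move: A; apply: smallest_sub.
  split => [|A mA|F mF] /=.
  - by rewrite preimage_set0.
  - by rewrite setTD preimage_setC; exact: measurableC.
  - by rewrite preimage_bigcup; exact: bigcup_measurable.
rewrite -bigcup_seq => A [i _ [B mB <-]] /=.
by rewrite setTI -[X in measurable X]setTI; exact: mf.
Qed.

Definition cons_rV (R : realType) n (p : R * 'rV[R]_n) : 'rV[R]_n.+1 :=
  row_mx (const_mx p.1 : 'rV_1) p.2.

Lemma cons_rV0 (R : realType) n (p : R * 'rV[R]_n) : cons_rV p ord0 ord0 = p.1.
Proof.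
have -> : ord0 = lshift n (ord0 : 'I_1) by exact/val_inj.
exact: etrans (row_mxEl _ _ _ _) (mxE _ _ _ _).
Qed.

Lemma cons_rVS (R : realType) n (p : R * 'rV[R]_n) i :
  cons_rV p ord0 (lift ord0 i) = p.2 ord0 i.
Proof.
have -> : lift ord0 i = rshift 1 i by exact/val_inj.
exact: row_mxEr.
Qed.

Lemma measurable_cons_rV (R : realType) n :
  measurable_fun [set: measurableTypeR R * 'rV[R]_n] (@cons_rV R n).
Proof.
apply/measurable_fun_rVP => i; have [->|i0] := eqVneq i ord0.
  under eq_fun do rewrite cons_rV0.
  exact: measurable_fst.
have [j ->] : exists j, i = lift ord0 j.
  by case: (unliftP ord0 i) i0 => [j -> _|->]; [exists j|rewrite eqxx].
under eq_fun do rewrite cons_rVS.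
exact: (measurableT_comp (measurable_coord j) measurable_snd).
Qed.

Section prod_cons.
Context {R : realType} {n : nat}.
Variables (m : {sigma_finite_measure set (measurableTypeR R) -> \bar R})
  (mu : {sigma_finite_measure set 'rV[R]_n -> \bar R}).

Definition prod_cons : set 'rV[R]_n.+1 -> \bar R :=
  pushforward (m \x mu)%E (@cons_rV R n).

Let prod_cons0 : prod_cons set0 = 0%E.
Proof. by rewrite /prod_cons /pushforward preimage_set0 measure0. Qed.

Let prod_cons_ge0 A : (0 <= prod_cons A)%E.
Proof. by rewrite /prod_cons /pushforward measure_ge0. Qed.

Let prod_cons_sigma_additive : semi_sigma_additive prod_cons.
Proof.
have mpre A : measurable A -> measurable (@cons_rV R n @^-1` A).
  by move=> mA; rewrite -[X in measurable X]setTI; exact: measurable_cons_rV.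
move=> F mF tF mUF; rewrite /prod_cons /pushforward preimage_bigcup.
apply: measure_semi_sigma_additive.
- by move=> i; exact: mpre.
- apply/trivIsetP => /= i j _ _ ij; rewrite -preimage_setI.
  by move/trivIsetP : tF => /(_ _ _ _ _ ij) ->//; rewrite preimage_set0.
- by rewrite -preimage_bigcup; exact: mpre.
Qed.

HB.instance Definition _ := isMeasure.Build _ _ _ prod_cons
  prod_cons0 prod_cons_ge0 prod_cons_sigma_additive.

Let prod_cons_sigma_finite : sigma_finite setT prod_cons.
Proof.
have /sigma_finiteP[F [TF ndF Foo]] := sigma_finiteT m.
have /sigma_finiteP[G [TG ndG Goo]] := sigma_finiteT mu.
pose u (v : 'rV[R]_n.+1) : measurableTypeR R * 'rV[R]_n :=
  (v ord0 ord0, \row_i v ord0 (lift ord0 i)).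
have uK p : u (cons_rV p) = p.
  case: p => x v; rewrite /u cons_rV0; congr pair.
  by apply/rowP => i; rewrite mxE cons_rVS.
have mfu : measurable_fun setT u.
  apply: measurable_fun_pair; first exact: measurable_coord.
  apply/measurable_fun_rVP => i; under eq_fun do rewrite mxE.
  exact: measurable_coord.
exists (fun i => u @^-1` (F i `*` G i)).
  apply/esym/seteqP; split => // v _.
  have [i _ Fi] : (\bigcup_i F i) (u v).1 by rewrite -TF.
  have [j _ Gj] : (\bigcup_i G i) (u v).2 by rewrite -TG.
  exists (maxn i j) => //; split.
    exact: (subsetPset _ _ (ndF _ _ (leq_maxl i j))).
  exact: (subsetPset _ _ (ndG _ _ (leq_maxr i j))).
move=> i; have [mF Fi] := Foo i; have [mG Gi] := Goo i; split.
  by rewrite -[X in measurable X]setTI; apply: mfu => //; exact: measurableX.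
rewrite /prod_cons /pushforward (_ : _ @^-1` _ = F i `*` G i).
  by rewrite product_measure1E// lte_mul_pinfty// ge0_fin_numE.
by rewrite -comp_preimage (_ : u \o _ = id)//; exact/funext.
Qed.

HB.instance Definition _ := @Measure_isSigmaFinite.Build _ _ _ prod_cons
  prod_cons_sigma_finite.

End prod_cons.

(* The n-dimensional Lebesgue measure V_n on R^n, as the n-fold product of the
   Lebesgue measure of R. *)
Fixpoint lebesgue_rV (R : realType) (n : nat) :
    {sigma_finite_measure set 'rV[R]_n -> \bar R} :=
  match n with
  | 0 => dirac (0 : 'rV[R]_0)
  | n'.+1 => prod_cons (@lebesgue_measure R) (lebesgue_rV R n')
  end.

Lemma lebesgue_rV_prod (R : realType) n (A : 'I_n -> set R) :
  (forall i, measurable (A i)) ->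
  (lebesgue_rV R n [set v | forall i, A i (v ord0 i)] =
   \prod_i lebesgue_measure (A i))%E.
Proof.
elim: n A => [|n IHn] A mA /=.
  by rewrite big_ord0 diracE mem_set// => -[].
rewrite big_ord_recl -IHn//.
have mB : measurable [set v : 'rV[R]_n | forall i, A (lift ord0 i) (v ord0 i)].
  rewrite [X in measurable X](_ : _ = \big[setI/setT]_(i < n)
    ((fun v : 'rV[R]_n => v ord0 i) @^-1` A (lift ord0 i))).
    apply: bigsetI_measurable => i _.
    by rewrite -[X in measurable X]setTI; apply: measurable_coord.
  apply/seteqP; split => v /=.
    by move=> Av; elim/big_ind : _ => [//|C D Cv Dv|i _]; [split|exact: Av].
  by move=> Av i; move: Av; rewrite (bigD1 i)//= => -[].
rewrite -product_measure1E//; last exact: mA.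
rewrite /prod_cons /pushforward; congr product_measure1.
apply/seteqP; split => [p Ap|p [A0 Ap] i].
  split => [|i /=]; first by rewrite -(cons_rV0 p); apply: Ap.
  by rewrite -cons_rVS; apply: Ap.
case: (unliftP ord0 i) => [j|] ->; first by rewrite cons_rVS; apply: Ap.
by rewrite cons_rV0.
Qed.

(* The library norm `|x| of a matrix is the sup norm. *)
Definition eucl_norm (R : realType) (n : nat) (x : 'rV[R]_n) : R :=
  Num.sqrt (\sum_(i < n) x ord0 i ^+ 2).

Definition eucl_ball (R : realType) (n : nat) : set 'rV[R]_n :=
  [set x | eucl_norm x <= 1].

Definition eucl_sphere (R : realType) (n : nat) : set 'rV[R]_n :=
  [set x | eucl_norm x = 1].

Definition conv_hull (R : realType) (n : nat) (A : set 'rV[R]_n) :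
    set 'rV[R]_n :=
  smallest (@convex_set R 'rV[R]_n) A.

(* The uniform distribution on the unit sphere is its unique rotation-invariant
   probability measure, here seen as a measure on R^n concentrated on the
   sphere. Invariance is under the whole orthogonal group, which for n >= 2 is
   equivalent to invariance under SO(n); for n = 1 it is what makes both points
   of S^0 equally likely. No such measure exists for n = 0, where the sphere is
   empty. *)
Definition uniform_on_sphere (R : realType) (n : nat)
    (mu : probability 'rV[R]_n R) : Prop :=
  mu (@eucl_sphere R n) = 1%E /\
  forall U : 'M[R]_n, U *m U^T = 1%:M ->
  forall A : set 'rV[R]_n, measurable A ->
    mu ((fun x => x *m U) @^-1` A) = mu A.

Definition mutually_independent d (T : measurableType d) d'
    (T' : measurableType d') (R : realType) (P : probability T R) (I : finType)
    (X : I -> T -> T') : Prop :=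
  forall (J : {set I}) (B : I -> set T'), (forall i, measurable (B i)) ->
    P (\bigcap_(i in [set` J]) (X i @^-1` B i)) =
    (\prod_(i in J) P (X i @^-1` B i))%E.

(* Main.v *)
Require Import Defs.
From HB Require Import structures.
From mathcomp Require Import all_boot all_order all_algebra.
From mathcomp Require Import all_classical all_reals all_analysis.
From mathcomp Require Import measurable_realfun.
From mathcomp Require Import ring lra.

Set Implicit Arguments.
Unset Strict Implicit.
Unset Printing Implicit Defensive.

Import Order.TTheory GRing.Theory Num.Theory.
Import numFieldNormedType.Exports.

Local Open Scope classical_set_scope.
Local Open Scope ring_scope.

(** In high dimension the volume of the unit ball lies in a shell of width about
    [1 / n] below the sphere: for [d = n ^ (- 1 - eta)] the ball of radius
    [1 - d] still has almost all of the volume, for [d = n ^ (- 1 + eta)] it has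
    almost none.  What matters is whether the polytope crosses that shell.  A
    cap of height [d] has angular radius about [sqrt (2 * d)], hence measure
    [d ^ (n / 2)] up to a factor [C ^ n], and with [d] close to [1 / n] this is
    [n ^ (- n / 2)], whence the threshold; factors [C ^ n] are absorbed by the
    gap [n ^ (eps * n / 4)] that [eps] leaves.

    Few points.  The bound holds for every position of the points on the sphere.
    A point [x] of the hull cannot be strictly separated from all the [X i] by
    the hyperplane through [x] orthogonal to [x], so [<X i, x> >= |x| ^ 2] for
    some [i] ([conv_hull_dot]).  If moreover [|x| > t], then [x] is within
    [sqrt (1 - t ^ 4)] of [t ^ 2 *: X i].  So the hull lies in the union of the
    ball of radius [t] and of [N] balls of radius [rho], where
    [rho ^ 2 >= 1 - t ^ 4], and its share of the volume of the ball is at most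
    [t ^ n + N * rho ^ n] ([lebesgue_conv_hull_le]).  With
    [t = 1 - n ^ (- 1 + eps / 2)] this tends to [0] ([small_N_rate]).

    Many points.  Comparing volumes, a maximal [rho]-separated subset of the
    sphere has at most [(3 / rho) ^ n] points ([sphere_net]).  The balls of
    radius [rho] around its points cover the sphere and have equal probability
    by invariance, so that probability is at least [(rho / 3) ^ n]
    ([uniform_cball_ge]).  By independence, the probability that one of these
    balls contains none of the [N] points is at most
    [(3 / rho) ^ n * exp (- N * (rho / 3) ^ n)].  Otherwise every unit vector is
    within [2 * rho] of some [X i], the support function of the hull is at least
    [1 - 2 * rho ^ 2] in every direction, and the hull contains the ball of that
    radius ([ball_sub_conv_hull]).  With [rho = n ^ (- (1 + eps / 2) / 2)] the
    failure probability tends to [0] and [(1 - 2 * rho ^ 2) ^ n] to [1]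
    ([large_N_rate]).

    The volume of the hull is a function on the sample space that is only ever
    compared with measurable ones: the integral of a nonnegative function is the
    supremum of the integrals of the simple functions below it, so it is
    monotone on all functions ([ge0_le_integral_lower]). *)

(** * Euclidean geometry of row vectors *)

Section euclid.
Context {R : realType} {n : nat}.
Implicit Types (x y z : 'rV[R]_n) (a : R).

(** As a matrix product, it gets bilinearity and invariance under orthogonal
    matrices from matrix identities. *)
Definition dot x y : R := (x *m y^T) ord0 ord0.

Lemma dotE x y : dot x y = \sum_(i < n) x ord0 i * y ord0 i.
Proof. by rewrite /dot mxE; apply: eq_bigr => i _; rewrite mxE. Qed.

Lemma dotC x y : dot x y = dot y x.
Proof. by rewrite !dotE; apply: eq_bigr => i _; rewrite mulrC. Qed.

Lemma dotDl x y z : dot (x + y) z = dot x z + dot y z.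
Proof. by rewrite /dot mulmxDl mxE. Qed.

Lemma dotZl a x y : dot (a *: x) y = a * dot x y.
Proof. by rewrite /dot -scalemxAl mxE. Qed.

Lemma dotNl x y : dot (- x) y = - dot x y.
Proof. by rewrite -scaleN1r dotZl mulN1r. Qed.

Lemma dotDr x y z : dot z (x + y) = dot z x + dot z y.
Proof. by rewrite dotC dotDl !(dotC _ z). Qed.

Lemma dotZr a x y : dot y (a *: x) = a * dot y x.
Proof. by rewrite dotC dotZl dotC. Qed.

Lemma dotNr x y : dot x (- y) = - dot x y.
Proof. by rewrite dotC dotNl dotC. Qed.

Definition dot_lin := (dotDl, dotDr, dotNl, dotNr, dotZl, dotZr).

Lemma dot_ge0 x : 0 <= dot x x.
Proof. by rewrite dotE; apply: sumr_ge0 => i _; rewrite -expr2 sqr_ge0. Qed.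

Lemma eucl_normE x : eucl_norm x = Num.sqrt (dot x x).
Proof. by rewrite /eucl_norm dotE; under eq_bigr do rewrite expr2. Qed.

Lemma eucl_norm_ge0 x : 0 <= eucl_norm x.
Proof. exact: sqrtr_ge0. Qed.

Lemma sqr_eucl_norm x : eucl_norm x ^+ 2 = dot x x.
Proof. by rewrite eucl_normE sqr_sqrtr// dot_ge0. Qed.

Lemma eucl_norm_le x a : 0 <= a -> (eucl_norm x <= a) = (dot x x <= a ^+ 2).
Proof.
by move=> a0; rewrite -sqr_eucl_norm ler_sqr// ?nnegrE ?eucl_norm_ge0.
Qed.

Lemma eucl_norm_eq1 x : (eucl_norm x = 1) <-> (dot x x = 1).
Proof.
rewrite -sqr_eucl_norm; split=> [->|/eqP]; first by rewrite expr1n.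
by rewrite sqrp_eq1 ?eucl_norm_ge0// => /eqP.
Qed.

Lemma dot_eq0 x : dot x x = 0 -> x = 0.
Proof.
rewrite dotE => /eqP; rewrite psumr_eq0; last first.
  by move=> i _; rewrite -expr2 sqr_ge0.
move=> /allP x0; apply/rowP => i; rewrite mxE; apply/eqP.
by have := x0 i (mem_index_enum _); rewrite -expr2 sqrf_eq0.
Qed.

Lemma eucl_normN x : eucl_norm (- x) = eucl_norm x.
Proof. by rewrite !eucl_normE !dot_lin opprK. Qed.

Lemma eucl_normZ a x : 0 <= a -> eucl_norm (a *: x) = a * eucl_norm x.
Proof.
by move=> a0; rewrite !eucl_normE !dot_lin mulrA sqrtrM ?mulr_ge0// -expr2
  sqrtr_sqr ger0_norm.
Qed.

Lemma cauchy_schwarz x y : dot x y <= eucl_norm x * eucl_norm y.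
Proof.
have [y0|y0] := eqVneq (dot y y) 0.
  by rewrite (dot_eq0 y0) dotC -(scale0r 0) dotZl mul0r mulr_ge0 ?eucl_norm_ge0.
have y_gt0 : 0 < dot y y by rewrite lt_def y0 dot_ge0.
apply: le_trans (ler_norm _) _.
rewrite -ler_sqr ?nnegrE ?mulr_ge0 ?eucl_norm_ge0// real_normK ?num_real//.
rewrite exprMn !sqr_eucl_norm.
(* The difference of the two sides, times [dot y y], is the squared norm of a
   multiple of the component of [x] orthogonal to [y]. *)
rewrite -subr_ge0 -(pmulr_rge0 _ y_gt0).
have := dot_ge0 (dot y y *: x - dot x y *: y); rewrite !dot_lin (dotC y x).
by congr (0 <= _); ring.
Qed.

Lemma eucl_normD x y : eucl_norm (x + y) <= eucl_norm x + eucl_norm y.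
Proof.
rewrite eucl_norm_le ?addr_ge0 ?eucl_norm_ge0// sqrrD !dot_lin !sqr_eucl_norm.
have := cauchy_schwarz x y; rewrite (dotC y x) mulr2n; lra.
Qed.

Lemma unit_normalize x : x != 0 ->
  eucl_norm x > 0 /\ eucl_norm ((eucl_norm x)^-1 *: x) = 1.
Proof.
move=> x0; have x_gt0 : eucl_norm x > 0.
  rewrite lt_def eucl_norm_ge0 andbT; apply: contra_neq x0 => x0.
  by apply: dot_eq0; rewrite -sqr_eucl_norm x0 expr0n.
by rewrite eucl_normZ ?invr_ge0 ?eucl_norm_ge0// mulVf ?gt_eqF.
Qed.

Lemma dot_orthogonal (U : 'M[R]_n) x y : U *m U^T = 1%:M ->
  dot (x *m U) (y *m U) = dot x y.
Proof.
by move=> UU; rewrite /dot trmx_mul mulmxA -(mulmxA x) UU mulmx1.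
Qed.

(** The reflection in the hyperplane orthogonal to [x - y] exchanges the unit
    vectors [x] and [y]. *)
Lemma orthogonal_transitive x y : eucl_norm x = 1 -> eucl_norm y = 1 ->
  exists2 U : 'M[R]_n, U *m U^T = 1%:M & x *m U = y.
Proof.
move=> /eucl_norm_eq1 x1 /eucl_norm_eq1 y1.
have [->|xy] := eqVneq x y.
  by exists 1%:M; rewrite ?mulmx1 ?trmx1 ?mulmx1.
pose w : 'rV[R]_n := x - y; pose q := dot w w.
(* As [x] and [y] have the same norm, the component of [x] along [w] is half
   of [w]. *)
have qE : q = 2 * dot x w by rewrite /q /w !dot_lin x1 y1 (dotC y x); ring.
have q0 : q != 0 by apply: contra_neq xy => /dot_eq0 /subr0_eq.
have mulmx_w z : z *m (w^T *m w) = dot z w *: w.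
  by rewrite mulmxA [z *m w^T]mx11_scalar mul_scalar_mx.
pose A : 'M[R]_n := w^T *m w.
have AT : A^T = A by rewrite trmx_mul trmxK.
have AA : A *m A = q *: A by rewrite -mulmxA mulmx_w scalemxAr.
exists (1%:M - (2 / q) *: A).
  have -> : (1%:M - (2 / q) *: A)^T = 1%:M - (2 / q) *: A.
    by rewrite [LHS]raddfB/= trmx1 [X in _ - X]linearZ/= AT.
  rewrite mulmxBl mul1mx mulmxBr mulmx1 -scalemxAl -scalemxAr AA !scalerA.
  rewrite -scalerBl -addrA -opprD -scalerDl [X in X *: _](_ : _ = 0).
    by rewrite scale0r subr0.
  by field.
rewrite mulmxBr mulmx1 -scalemxAr mulmx_w scalerA.
rewrite (_ : 2 / q * _ = 1) ?scale1r ?subKr//.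
by rewrite mulrAC -qE divff.
Qed.

End euclid.
(** * Convex hulls *)

Lemma continuous_sum (R : realType) (T : topologicalType)
    N (f : 'I_N -> T -> R) :
  (forall i, continuous (f i)) -> continuous (fun t => \sum_i f i t).
Proof.
by move=> cf t; apply: cvg_big => [|i _]; [exact: add_continuous|exact: cf].
Qed.

Section convex_hull.
Context {R : realType} {n : nat}.
Implicit Types (x y z : 'rV[R]_n).

(** Otherwise the open half-space of the [y] with [dot y x < dot x x] would be a
    convex set that contains [A] but not [x]. *)
Lemma conv_hull_dot (A : set 'rV[R]_n) x : conv_hull A x ->
  exists2 y, A y & dot x x <= dot y x.
Proof.
move=> Ax; apply: contrapT => noy.
suff : dot x x < dot x x by rewrite ltxx.
apply: (Ax [set y | dot y x < dot x x]); split; last first.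
  by move=> y Ay /=; rewrite ltNge; apply/negP => xy; apply: noy; exists y.
apply/convex_setW => y z /set_mem/= yx /set_mem/= zx k k0 k1.
have : k%:num * dot y x + (1 - k%:num) * dot z x < dot x x by nra.
by move=> kx; apply/mem_set; rewrite /= dotDl !dotZl.
Qed.

Lemma convex_set_sum N (A : set 'rV[R]_n) (X : 'I_N -> 'rV[R]_n)
    (w : 'I_N -> R) : convex_set (A : set (convex_lmodType _)) ->
  (forall i, A (X i)) -> (forall i, 0 <= w i) -> \sum_i w i = 1 ->
  A (\sum_i w i *: X i).
Proof.
move=> cA; elim: N X w => [|N IHN] X w AX w0.
  by rewrite big_ord0 => /esym/eqP; rewrite oner_eq0.
rewrite !big_ord_recl => w1; set s := \sum_i w (lift ord0 i) in w1.
have s_ge0 : 0 <= s by apply: sumr_ge0.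
have [s0|s_neq0] := eqVneq s 0.
  rewrite big1 => [|i _]; last first.
    move/eqP : s0; rewrite psumr_eq0// => /allP/(_ i (mem_index_enum _)).
    by move=> /eqP ->; rewrite scale0r.
  by rewrite addr0 (_ : w _ = 1) ?scale1r//; lra.
have w01 : 0 <= w ord0 <= 1 by rewrite w0 -w1 lerDl.
have -> : \sum_(i < N) w (lift ord0 i) *: X (lift ord0 i) =
    (1 - w ord0) *: \sum_(i < N) (w (lift ord0 i) / s) *: X (lift ord0 i).
  rewrite scaler_sumr; apply: eq_bigr => i _; rewrite scalerA.
  by congr (_ *: _); rewrite -w1; field.
pose k := Itv01 (andP w01).1 (andP w01).2.
have AS : A (\sum_(i < N) (w (lift ord0 i) / s) *: X (lift ord0 i)).
  apply: IHN => [i|i|]; [exact: AX|by rewrite divr_ge0|].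
  by rewrite -mulr_suml divff.
exact: (set_mem (cA _ _ k (mem_set (AX ord0)) (mem_set AS))).
Qed.

Lemma compact_simplex N :
  compact [set w : 'rV[R]_N | (forall i, 0 <= w ord0 i) /\
                              \sum_i w ord0 i = 1].
Proof.
have cont_sum : continuous (fun w : 'rV[R]_N => \sum_i w ord0 i).
  by move=> w; apply: continuous_sum => i; exact: coord_continuous.
rewrite (_ : mkset _ =
    [set w : 'rV[R]_N | forall i, `[0, 1]%classic (w ord0 i)] `&`
    (fun w : 'rV[R]_N => \sum_i w ord0 i) @^-1` [set 1]).
  apply: compact_closedI; first by
    apply: (@rV_compact R N (fun=> `[0, 1]%classic)) => i;
    exact: segment_compact.
  have /continuous_closedP := cont_sum; apply; exact: closed_eq.
apply/seteqP; split => w /= [w0 w1]; split=> // i; last first.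
  by have := w0 i; rewrite /= in_itv/= => /andP[].
by rewrite in_itv/= w0/= -w1 (bigD1 i)//= lerDl; apply: sumr_ge0.
Qed.

(** The hypothesis says that the support function of the hull is at least [r].
    Let [s] be the point of the hull closest to [x].  If [s <> x], some [X i] is
    at least as far as [x] in the direction of [x - s], so that moving from [s]
    a little towards [X i] stays in the hull and comes closer to [x]. *)
Lemma ball_sub_conv_hull N (X : 'I_N -> 'rV[R]_n) (r : R) :
  (0 < N)%N ->
  (forall u, eucl_norm u = 1 -> exists i, r <= dot (X i) u) ->
  forall x, eucl_norm x <= r -> conv_hull (range X) x.
Proof.
move=> N0 rX x xr.
pose D := [set w : 'rV[R]_N | (forall i, 0 <= w ord0 i) /\
                              \sum_i w ord0 i = 1].
pose comb (w : 'rV[R]_N) := \sum_i w ord0 i *: X i.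
pose f (w : 'rV[R]_N) : R := dot (x - comb w) (x - comb w).
have D0 : D !=set0.
  exists (\row_i (i == Ordinal N0)%:R).
  split=> [i|]; first by rewrite mxE ler0n.
  rewrite (bigD1 (Ordinal N0))//= big1 ?addr0 ?mxE ?eqxx// => i iN0.
  by rewrite mxE (negbTE iN0).
have cf : continuous f.
  have -> : f = (fun w : 'rV[R]_N => \sum_(j < n)
     (x ord0 j - \sum_(i < N) w ord0 i * X i ord0 j) *
     (x ord0 j - \sum_(i < N) w ord0 i * X i ord0 j)).
    apply/funext => w; rewrite /f dotE; apply: eq_bigr => j _.
    rewrite !mxE summxE (eq_bigr (fun i => w ord0 i * X i ord0 j))// => i _.
    by rewrite mxE.
  apply: continuous_sum => j w.
  suff : {for w, continuous (fun v : 'rV[R]_N =>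
      x ord0 j - \sum_(i < N) v ord0 i * X i ord0 j)} 
    by move=> cw; exact: (cvgM cw cw).
  have cs : continuous (fun v : 'rV[R]_N => \sum_(i < N) v ord0 i * X i ord0 j).
    apply: continuous_sum => i v.
    exact: (cvgM (@coord_continuous R 1 N ord0 i v) (cvg_cst _)).
  exact: (@cvgB R R^o _ _ _ _ _ _ _ (cvg_cst _) (cs w)).
have [w /set_mem[w0 w1] minw] := compact_EVT_min D0 (@compact_simplex N)
  (continuous_subspaceT cf).
pose s := comb w.
have convs : conv_hull (range X) s.
  by move=> A [cA XA]; apply: convex_set_sum => // i; apply: XA; exists i.
have [<-//|xs] := eqVneq s x.
pose d := x - s.
have d0 : d != 0 by rewrite subr_eq0 eq_sym.
have [d_gt0 u1] := unit_normalize d0.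
have [i ri] := rX _ u1.
have dd_gt0 : 0 < dot d d by rewrite -sqr_eucl_norm exprn_gt0.
have dX : dot d d <= dot d (X i - s).
  have : dot x d <= dot (X i) d.
    have := le_trans (cauchy_schwarz x d) _.
    move=> /(_ (r * eucl_norm d)) h; apply: le_trans (h _) _.
      by rewrite ler_wpM2r// ltW.
    by rewrite -ler_pdivlMr// mulrC -dotZr.
  have -> : dot d d = dot x d - dot s d by rewrite -dotNl -dotDl.
  by rewrite dotDr dotNr !(dotC d) => xd; rewrite lerD2r.
set e := X i - s in dX.
(* Moving by [t *: e] changes the squared distance by at most
   [t * (t * dot e e - 2 * dot d d)], which is negative for this [t]. *)
pose t := dot d d / (dot d d + dot e e).
have den : 0 < dot d d + dot e e by rewrite ltr_wpDr// dot_ge0.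
have t0 : 0 < t by rewrite divr_gt0.
have t1 : t <= 1 by rewrite ler_pdivrMr// mul1r lerDl dot_ge0.
have te : t * (dot d d + dot e e) = dot d d by rewrite divfK// gt_eqF.
have dE : d = x - s by [].
have eE : e = X i - s by [].
clearbody t d e.
pose w' : 'rV[R]_N := \row_j ((1 - t) * w ord0 j + t * (j == i)%:R).
have Dw' : D w'.
  split=> [j|].
    by rewrite mxE addr_ge0// mulr_ge0 ?subr_ge0 ?ler0n// ltW.
  under eq_bigr do rewrite mxE.
  rewrite big_split/= -!mulr_sumr w1 (bigD1 i)//= big1 ?eqxx.
    by rewrite addr0 !mulr1 subrK.
  by move=> j /negbTE ->.
have combw' : comb w' = s + t *: e.
  rewrite /comb; under eq_bigr do rewrite mxE scalerDl -!scalerA.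
  rewrite big_split/= -!scaler_sumr -/(comb w) -/s.
  rewrite [X in _ + _ *: X](_ : _ = X i).
    by rewrite eE scalerBr scalerBl scale1r -addrA (addrC (- _)).
  rewrite (bigD1 i)//= big1 ?eqxx ?scale1r ?addr0// => j /negbTE ->.
  by rewrite scale0r.
have := minw _ (mem_set Dw').
rewrite /f combw' -/s opprD addrA -dE !dot_lin (dotC e d).
have e0 := dot_ge0 e.
move=> h.
have : 2 * t * dot d e <= t * (t * dot e e) by lra.
have : t * (dot d d) <= t * dot d e by rewrite ler_pM2l.
have : t * (t * dot e e) <= t * (dot d d - t * dot d d).
  by rewrite ler_pM2l//; lra.
have : 0 < t * dot d d by rewrite mulr_gt0.
have : 0 < t * (t * dot d d) by rewrite mulr_gt0// mulr_gt0.
lra.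
Qed.

End convex_hull.
(** * Lebesgue measure of Euclidean balls *)

(** The integral of a nonnegative function is the supremum of the integrals of
    the simple functions below it, and those below [f] are also below [g]. *)
Lemma ge0_le_integral_lower d (T : measurableType d) (R : realType)
    (mu : {measure set T -> \bar R}) (f g : T -> \bar R) :
  (forall x, 0 <= f x)%E -> (forall x, f x <= g x)%E ->
  (\int[mu]_x f x <= \int[mu]_x g x)%E.
Proof.
move=> f0 fg; have g0 x : (0 <= g x)%E by exact: le_trans (fg x).
rewrite !ge0_integralTE//; apply: ge_ereal_sup => _ [h hf <-].
apply: ereal_sup_ubound; exists h => //= x.
exact: le_trans (hf x) (fg x).
Qed.

(** On an arbitrary set the value is an iterated integral of indicator functions
    of sections, and each of these integrals is monotone. *)
Lemma le_lebesgue_rV (R : realType) n (A B : set 'rV[R]_n) :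
  A `<=` B -> (lebesgue_rV R n A <= lebesgue_rV R n B)%E.
Proof.
elim: n A B => [|n IHn] A B AB /=.
  rewrite !diracE lee_fin ler_nat.
  by have [/set_mem/AB/mem_set ->|//] := boolP (_ \in A).
apply: ge0_le_integral_lower => x /=; first exact: measure_ge0.
by apply: IHn => y; rewrite /xsection/= !inE; exact: AB.
Qed.

Section affine_change_of_variable.
Context {R : realType} (c r : R).
Hypothesis r0 : 0 < r.
Notation mu := (@lebesgue_measure R).

Let f (t : measurableTypeR R) : measurableTypeR R := c + r * (t : R).

Let mf : measurable_fun [set: measurableTypeR R] f.
Proof. by apply: measurable_funD => //; exact: measurable_funM. Qed.

Let push : {measure set (measurableTypeR R) -> \bar R}.
Proof. by unshelve refine (pushforward mu f); exact: mf. Defined.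

Let nu := mscale (NngNum (ltW r0)) push.

Lemma lebesgue_measure_affine (A : set (measurableTypeR R)) :
  measurable A -> (mu A = r%:E * mu (f @^-1` A))%E.
Proof.
move=> mA; apply: (@lebesgue_measure_unique R nu) => // _ [[a b]] _ <-.
rewrite /nu/= /mscale/= /pushforward.
rewrite (_ : f @^-1` _ = `](a - c) / r, (b - c) / r]%classic).
  rewrite !lebesgue_measure_itv/= !lte_fin ltr_pM2r ?invr_gt0// ltrD2r.
  case: ifPn => // _; last by rewrite mule0.
  rewrite -!EFinD -EFinM; congr EFin; field; exact: lt0r_neq0.
apply/seteqP; split => t /=; rewrite !in_itv/= ltr_pdivrMr// ler_pdivlMr//.
  by move=> /andP[]; rewrite /f => h1 h2; apply/andP; split; lra.
by move=> /andP[]; rewrite /f => h1 h2; apply/andP; split; lra.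
Qed.

Lemma ge0_integral_affine (g : measurableTypeR R -> \bar R) :
  measurable_fun setT g -> (forall t, 0 <= g t)%E ->
  (\int[mu]_t g t = r%:E * \int[mu]_t g (c + r * t)%R)%E.
Proof.
move=> mg g0; rewrite (eq_measure_integral nu); last first.
  by move=> A mA _; exact: lebesgue_measure_affine.
by rewrite ge0_integral_mscale// ge0_integral_pushforward.
Qed.

End affine_change_of_variable.

Section euclidean_balls.
Context {R : realType}.

(** Fubini, with the substitution [t -> c + r * t] in the first coordinate and
    induction on the sections. *)
Lemma lebesgue_rV_affine n (c : 'rV[R]_n) (r : R) (A : set 'rV[R]_n) :
  0 < r -> measurable A ->
  lebesgue_rV R n A =
  ((r ^+ n)%:E * lebesgue_rV R n [set x | A (c + r *: x)%R])%E.
Proof.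
move=> r0; elim: n c A => [|n IHn] c A mA.
  rewrite expr0 mul1e /= !diracE; congr (_%:R%:E); congr nat_of_bool.
  by apply/idP/idP => /set_mem A0; apply/mem_set; move: A0; rewrite /= !thinmx0.
have mcons (B : set 'rV[R]_n.+1) : measurable B ->
    measurable (@cons_rV R n @^-1` B).
  by move=> mB; rewrite -[X in measurable X]setTI; exact: measurable_cons_rV.
pose c' := \row_i c ord0 (lift ord0 i).
have consE s y : c + r *: cons_rV (s, y) =
    cons_rV (c ord0 ord0 + r * s, c' + r *: y).
  have E m (u v : 'rV[R]_m) j : (u + r *: v) ord0 j = u ord0 j + r * v ord0 j.
    by rewrite !mxE.
  apply/rowP => i; rewrite E; case: (unliftP ord0 i) => [j|] ->.
    by rewrite !cons_rVS E mxE.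
  by rewrite !cons_rV0.
pose G (s : measurableTypeR R) :=
  lebesgue_rV R n (xsection (@cons_rV R n @^-1` A) s).
have mG : measurable_fun setT G.
  by apply: measurable_fun_xsection; exact: mcons.
have G0 s : (0 <= G s)%E by exact: measure_ge0.
transitivity (\int[@lebesgue_measure R]_s G s)%E; first by [].
rewrite (ge0_integral_affine (c ord0 ord0) r0 mG G0).
transitivity (r%:E * \int[@lebesgue_measure R]_s ((r ^+ n)%:E *
  lebesgue_rV R n
    (xsection (@cons_rV R n @^-1` [set x | A (c + r *: x)%R]) s)))%E.
  congr (_ * _)%E; apply: eq_integral => s _; rewrite /G (IHn c'); last first.
    apply: measurable_xsection; exact: mcons.
  congr (_ * lebesgue_rV R n _)%E.
  by apply/seteqP; split => y; rewrite /xsection/= !inE/= consE.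
rewrite ge0_integralZl//.
- by rewrite muleA -EFinM -exprS.
- apply: measurable_fun_xsection; apply: mcons.
  rewrite -[X in measurable X]setTI.
  suff : measurable_fun setT (fun x : 'rV[R]_n.+1 => c + r *: x : 'rV[R]_n.+1).
    by move/(_ measurableT _ mA).
  apply/measurable_fun_rVP => i; under eq_fun do rewrite !mxE.
  apply: measurable_funD => //; apply: measurable_funM => //.
  exact: measurable_coord.
- by rewrite lee_fin exprn_ge0// ltW.
Qed.

Definition cball n (c : 'rV[R]_n) (r : R) : set 'rV[R]_n :=
  [set x | eucl_norm (x - c) <= r].

Lemma measurable_cball n (c : 'rV[R]_n) r : measurable (cball c r).
Proof.
have [r0|r0] := ltP r 0.
  rewrite (_ : cball c r = set0)//; apply/seteqP; split => // x.
  by rewrite /cball/= leNgt (lt_le_trans r0) ?eucl_norm_ge0.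
pose f (x : 'rV[R]_n) := \sum_(i < n) (x ord0 i - c ord0 i) ^+ 2.
have mf : measurable_fun setT f.
  apply: measurable_sum => i; apply: measurable_funX.
  by apply: measurable_funB => //; exact: measurable_coord.
rewrite (_ : cball c r = f @^-1` `]-oo, r ^+ 2]).
  by rewrite -[X in measurable X]setTI; exact: mf.
apply/seteqP; split => x; rewrite /cball/= in_itv/= eucl_norm_le// dotE /f.
  by under eq_bigr do rewrite !mxE -expr2.
by under [X in _ -> X <= _]eq_bigr do rewrite !mxE -expr2.
Qed.

Lemma lebesgue_cball n (c : 'rV[R]_n) r : 0 < r ->
  lebesgue_rV R n (cball c r) =
  ((r ^+ n)%:E * lebesgue_rV R n (@eucl_ball R n))%E.
Proof.
move=> r0; rewrite (lebesgue_rV_affine c r0); last exact: measurable_cball.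
congr (_ * lebesgue_rV R n _)%E; apply/seteqP; split => x;
  by rewrite /cball/eucl_ball/= addrC addKr (eucl_normZ _ (ltW r0)) ger_pMr.
Qed.

(** The ball contains the cube of half-side [1 / (n + 1)]. *)
Lemma lebesgue_eucl_ball_gt0 n : (0 < lebesgue_rV R n (@eucl_ball R n))%E.
Proof.
pose e : R := n.+1%:R^-1.
have e0 : 0 < e by rewrite invr_gt0.
apply: (@lt_le_trans _ _ (lebesgue_rV R n
    [set v | forall i, `[- e, e]%classic (v ord0 i)])); last first.
  apply: le_lebesgue_rV => x xe; rewrite /eucl_ball/= eucl_norm_le// dotE.
  rewrite expr1n; apply: (@le_trans _ _ (\sum_(i < n) n.+1%:R^-1)).
    apply: ler_sum => i _; have := xe i; rewrite /= in_itv/= -ler_norml => xie.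
    have e1 : e <= 1 by rewrite invf_le1// ler1n.
    rewrite -expr2 -real_normK ?num_real// -/e (@le_trans _ _ (e ^+ 2))//.
      by rewrite ler_sqr ?nnegrE// ltW.
    by rewrite expr2 ger_pMl.
  rewrite sumr_const card_ord -[_ *+ n]mulr_natl ler_pdivrMr// mul1r ler_nat.
  exact: leqnSn.
rewrite (@lebesgue_rV_prod R n (fun=> `[- e, e]%classic))//.
apply: (big_ind (fun x : \bar R => 0 < x)%E) => // [x y|i _].
  exact: mule_gt0.
by rewrite lebesgue_measure_itv/= lte_fin gtrN// -EFinB lte_fin opprK addr_gt0.
Qed.

(** The ball is contained in the cube of half-side [1]. *)
Lemma lebesgue_eucl_ball_fin n : lebesgue_rV R n (@eucl_ball R n) \is a fin_num.
Proof.
rewrite ge0_fin_numE ?measure_ge0//.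
apply: (@le_lt_trans _ _ (lebesgue_rV R n
    [set v | forall i, `[- 1, 1]%classic (v ord0 i)])).
  apply: le_lebesgue_rV => x; rewrite /eucl_ball/= eucl_norm_le// dotE expr1n.
  move=> x1 i; rewrite /= in_itv/= -ler_norml -ler_sqr ?nnegrE// expr1n.
  rewrite real_normK ?num_real// (le_trans _ x1)// (bigD1 i)//= -expr2 lerDl.
  by apply: sumr_ge0 => j _; rewrite -expr2 sqr_ge0.
rewrite (@lebesgue_rV_prod R n (fun=> `[- 1, 1]%classic))//.
rewrite (eq_bigr (fun=> 2%:E)) => [|i _].
  by rewrite prodEFin ltry.
by rewrite lebesgue_measure_itv/= lte_fin gtrN// -EFinB opprK.
Qed.

End euclidean_balls.
(** * Packings, and volume bounds for a given position of the points *)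

Lemma measure_bigsetU_le d (T : measurableType d) (R : realType)
    (mu : {measure set T -> \bar R}) (I : finType) (A : I -> set T) :
  (forall i, measurable (A i)) ->
  (mu (\big[setU/set0]_i A i) <= \sum_i mu (A i))%E.
Proof.
move=> mA; suff [] : measurable (\big[setU/set0]_i A i) /\
  (mu (\big[setU/set0]_i A i) <= \sum_i mu (A i))%E by [].
apply: (big_ind2 (fun B x => measurable B /\ (mu B <= x)%E)).
- by rewrite measure0; split.
- move=> B x C y [mB Bx] [mC Cy]; split; first exact: measurableU.
  by apply: le_trans (leeD Bx Cy); exact: measureU2.
- by move=> i _; split.
Qed.

Section deterministic.
Context {R : realType} {n : nat}.
Notation V := (lebesgue_rV R n).
Notation B := (@eucl_ball R n).

(** The balls of radius [rho / 2] around the points are disjoint and contained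
    in the ball of radius [1 + rho / 2 <= 3 / 2]; compare volumes. *)
Lemma packing_bound (M : nat) (v : nat -> 'rV[R]_n) (rho : R) :
  0 < rho <= 1 -> (forall i, (i < M)%N -> eucl_norm (v i) = 1) ->
  (forall i j, (i < j < M)%N -> rho < eucl_norm (v j - v i)) ->
  M%:R * (rho / 3) ^+ n <= 1.
Proof.
move=> /andP[rho0 rho1] v1 vsep.
pose F i := cball (v i) (rho / 2).
have mF i : measurable (F i) by exact: measurable_cball.
have tF : trivIset `I_M F.
  suff dF i j : (i < j < M)%N -> F i `&` F j = set0.
    apply/trivIsetP => i j /= iM jM; rewrite neq_ltn => /orP[]ij.
      by apply: dF; rewrite ij.
    by rewrite setIC; apply: dF; rewrite ij.
  move=> /andP[ij jM]; apply/seteqP; split => // x [xi xj].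
  rewrite /F/cball/= in xi xj.
  have := vsep i j; rewrite ij jM => /(_ isT); rewrite ltNge => /negP; apply.
  have -> : v j - v i = - (x - v j) + (x - v i) by rewrite opprB addrA subrK.
  by apply: le_trans (eucl_normD _ _) _; rewrite eucl_normN; lra.
have : (V (\big[setU/set0]_(i < M) F i) <=
        V (cball (0 : 'rV[R]_n) (1 + rho / 2)))%E.
  apply: le_lebesgue_rV => x; rewrite -bigcup_mkord => -[i /= iM].
  rewrite /F/cball/= subr0 => xi; rewrite -[x](subrK (v i)).
  by apply: le_trans (eucl_normD _ _) _; rewrite v1//; lra.
rewrite measure_semi_additive_ord_I//; last exact: bigsetU_measurable.
rewrite lebesgue_cball; last lra.
rewrite (eq_bigr (fun=> ((rho / 2) ^+ n)%:E * V B)%E); last first.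
  by move=> i _; apply: lebesgue_cball; rewrite divr_gt0.
have v_gt0 := @lebesgue_eucl_ball_gt0 R n.
rewrite -ge0_sume_distrl; last first.
  by move=> i _; rewrite lee_fin exprn_ge0// divr_ge0// ltW.
rewrite lee_pmul2r// ?lebesgue_eucl_ball_fin// sumEFin lee_fin.
rewrite sumr_const card_ord -[_ *+ M]mulr_natl => h.
have -> : rho / 3 = (rho / 2) * (2 / 3) by field.
rewrite exprMn mulrA; apply: le_trans (ler_wpM2r _ h) _.
  by rewrite exprn_ge0.
by rewrite -exprMn exprn_ile1//; nra.
Qed.

(** A largest [rho]-separated family exists by the packing bound, and it is a
    net since a point far from all its members could be added to it. *)
Lemma sphere_net (rho : R) : 0 < rho <= 1 ->
  exists M (v : nat -> 'rV[R]_n),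
    [/\ M%:R * (rho / 3) ^+ n <= 1,
        forall i, (i < M)%N -> eucl_norm (v i) = 1 &
        forall u, eucl_norm u = 1 ->
          exists2 i, (i < M)%N & eucl_norm (u - v i) <= rho].
Proof.
move=> rho01; have [rho0 rho1] := andP rho01.
pose sep M := exists v : nat -> 'rV[R]_n,
  (forall i, (i < M)%N -> eucl_norm (v i) = 1) /\
  (forall i j, (i < j < M)%N -> rho < eucl_norm (v j - v i)).
have sep0 : exists M, `[< sep M >].
  exists 0%N; apply/asboolP; exists (fun=> 0).
  by split => // i j; rewrite ltn0 andbF.
have rho3 : 0 < (rho / 3) ^+ n by rewrite exprn_gt0// divr_gt0.
have bound M : `[< sep M >] -> (M <= Num.truncn ((rho / 3) ^+ n)^-1)%N.
  move=> /asboolP[v [v1 vsep]]; have := packing_bound rho01 v1 vsep.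
  rewrite -ler_pdivlMr// mul1r => Mle.
  by rewrite truncn_ge_nat// invr_ge0 ltW.
case: (ex_maxnP sep0 bound) => M /asboolP[v [v1 vsep]] maxM.
exists M, v; split => //; first exact: packing_bound rho01 v1 vsep.
move=> u u1; apply: contrapT => far.
suff : sep M.+1 by move=> /asboolP/maxM; rewrite ltnn.
exists (fun i => if i == M then u else v i); split => [i|i j /andP[ij]].
  by case: eqP => // iM; rewrite ltnS leq_eqVlt => /orP[/eqP//|]; exact: v1.
rewrite ltnS => jM; have iM : (i < M)%N := leq_trans ij jM.
rewrite (ltn_eqF iM); case: eqP => [_|/eqP jM'].
  by rewrite ltNge; apply/negP => ui; apply: far; exists i.
by apply: vsep; rewrite ij ltn_neqAle jM'.
Qed.

(** A point [x] of the hull outside the ball of radius [t] has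
    [dot (X i) x >= t ^ 2] for some [i], and then
    [|x - t ^ 2 *: X i| ^ 2 <= 1 - 2 * t ^ 4 + t ^ 4]. *)
Lemma lebesgue_conv_hull_le N (X : 'I_N -> 'rV[R]_n) (t rho : R) :
  (forall i, eucl_norm (X i) = 1) -> 0 < t -> 0 < rho ->
  1 - t ^+ 4 <= rho ^+ 2 ->
  (V (conv_hull (range X)) <= (t ^+ n + N%:R * rho ^+ n)%:E * V B)%E.
Proof.
move=> X1 t0 rho0 trho.
pose A := cball (0 : 'rV[R]_n) t.
pose C (i : 'I_N) := cball (t ^+ 2 *: X i) rho.
have mU : measurable (\big[setU/set0]_(i < N) C i).
  by apply: bigsetU_measurable => i _; exact: measurable_cball.
apply: (@le_trans _ _ (V (A `|` \big[setU/set0]_(i < N) C i))).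
  apply: le_lebesgue_rV => x /conv_hull_dot[_ [i _ <-] xXi].
  have [xt|tx] := leP (eucl_norm x) t; first by left; rewrite /A/cball/= subr0.
  right; rewrite -bigcup_seq/=; exists i; first by rewrite /= mem_index_enum.
  rewrite /C/cball/= eucl_norm_le ?(ltW rho0)//; apply: le_trans trho.
  rewrite !dot_lin -!sqr_eucl_norm X1 expr1n (dotC x).
  have := cauchy_schwarz (X i) x; rewrite X1 mul1r => cs.
  have x1 : eucl_norm x <= 1.
    rewrite -sqr_eucl_norm in xXi.
    have x0 : 0 < eucl_norm x by exact: lt_trans tx.
    by rewrite -(ler_pM2r x0) mul1r -expr2 (le_trans xXi).
  rewrite -sqr_eucl_norm in xXi.
  have : t ^+ 2 <= eucl_norm x ^+ 2.
    by rewrite ler_sqr ?nnegrE ?ltW// (lt_trans t0).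
  have : eucl_norm x ^+ 2 <= 1 by rewrite exprn_ile1// ltW// (lt_trans t0).
  have t2 : 0 <= t ^+ 2 by rewrite sqr_ge0.
  have -> : t ^+ 4 = t ^+ 2 * t ^+ 2 by rewrite -exprD.
  by nra.
apply: le_trans (measureU2 _ _ _) _ => //; first exact: measurable_cball.
have tn0 : 0 <= t ^+ n by rewrite exprn_ge0// ltW.
have Nrho0 : 0 <= N%:R * rho ^+ n by rewrite mulr_ge0// exprn_ge0// ltW.
rewrite EFinD ge0_muleDl ?lee_fin//.
apply: leeD.
  have VA : V A = ((t ^+ n)%:E * V B)%E by exact: lebesgue_cball.
  by rewrite -VA.
apply: le_trans (measure_bigsetU_le _ _) _.
  by move=> i; exact: measurable_cball.
rewrite (eq_bigr (fun=> ((rho ^+ n)%:E * V B)%E)); last first.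
  by move=> i _; exact: lebesgue_cball.
rewrite -ge0_sume_distrl; last by move=> i _; rewrite lee_fin exprn_ge0// ltW.
by rewrite sumEFin sumr_const card_ord mulr_natl.
Qed.

(** Every unit vector [u] is within [2 * rho] of some [X j], which for unit
    vectors means [dot (X j) u >= 1 - 2 * rho ^ 2]. *)
Lemma ball_sub_conv_hull_net N M (X : 'I_N -> 'rV[R]_n) (v : nat -> 'rV[R]_n)
    (rho : R) : (0 < N)%N -> 0 <= rho ->
  (forall i, eucl_norm (X i) = 1) ->
  (forall u, eucl_norm u = 1 ->
     exists2 i, (i < M)%N & eucl_norm (u - v i) <= rho) ->
  (forall i, (i < M)%N -> exists j, eucl_norm (X j - v i) <= rho) ->
  cball 0 (1 - 2 * rho ^+ 2) `<=` conv_hull (range X).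
Proof.
move=> N0 rho0 X1 netv Xv x; rewrite /cball/= subr0.
apply: ball_sub_conv_hull => // u u1.
have [i iM ui] := netv _ u1; have [j Xj] := Xv _ iM; exists j.
have : eucl_norm (X j - u) <= 2 * rho.
  have -> : X j - u = (X j - v i) + - (u - v i) by rewrite opprB addrA subrK.
  by apply: le_trans (eucl_normD _ _) _; rewrite eucl_normN; lra.
rewrite eucl_norm_le ?mulr_ge0// !dot_lin.
rewrite -!sqr_eucl_norm X1 u1 (dotC u) exprMn; lra.
Qed.

End deterministic.
(** * The uniform distribution on the sphere *)

Section uniform_sphere.
Context {R : realType} {n : nat}.

Lemma measurable_eucl_sphere : measurable (@eucl_sphere R n).
Proof.
rewrite (_ : @eucl_sphere R n =
    cball 0 1 `\` \bigcup_k cball 0 (1 - k.+1%:R^-1)).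
  apply: measurableD; first exact: measurable_cball.
  by apply: bigcup_measurable => k _; exact: measurable_cball.
apply/seteqP; split => x; rewrite /eucl_sphere/cball/= subr0.
  move=> x1; rewrite x1; split => // -[k _] /=.
  by rewrite subr0 x1 lerBrDl gerDr leNgt invr_gt0 ltr0n.
move=> [x1 xk]; apply/eqP; rewrite eq_le x1 leNgt; apply/negP => x_lt1.
have [k kx] := ltr_add_invr x_lt1.
by apply: xk; exists k => //=; rewrite subr0 lerBrDr ltW.
Qed.

Variable mu : probability 'rV[R]_n R.
Hypothesis unif : uniform_on_sphere mu.

Lemma uniform_cball_eq (u v : 'rV[R]_n) rho :
  eucl_norm u = 1 -> eucl_norm v = 1 -> mu (cball u rho) = mu (cball v rho).
Proof.
move=> u1 v1; have [U UU uU] := orthogonal_transitive u1 v1.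
rewrite -[RHS](unif.2 _ UU); last exact: measurable_cball.
congr (mu _); apply/seteqP; split => x; rewrite /cball/= -uU -mulmxBl;
  by rewrite !eucl_normE dot_orthogonal.
Qed.

(** The balls of radius [rho] around a net of at most [(3 / rho) ^ n] points
    cover the sphere and all have the probability of [cball u rho]. *)
Lemma uniform_cball_ge (u : 'rV[R]_n) rho : 0 < rho <= 1 ->
  eucl_norm u = 1 -> (((rho / 3) ^+ n)%:E <= mu (cball u rho))%E.
Proof.
move=> rho01 u1; have [M [v [Mle v1 netv]]] := @sphere_net R n rho rho01.
have mC i : measurable (cball (v i) rho) by exact: measurable_cball.
have : (1 <= \sum_(i < M) mu (cball (v i) rho))%E.
  rewrite -unif.1.
  apply: le_trans (measure_bigsetU_le mu (fun i : 'I_M => mC i)).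
  apply: le_measure; rewrite ?inE; first exact: measurable_eucl_sphere.
    by apply: bigsetU_measurable.
  move=> x /netv[i iM xi]; rewrite -(bigcup_mkord M (fun i => cball (v i) rho)).
  by exists i.
rewrite (eq_bigr (fun=> mu (cball u rho))) => [|i _]; last first.
  by apply: uniform_cball_eq => //; exact: v1.
have pfin : mu (cball u rho) \is a fin_num.
  by apply: fin_num_measure; exact: measurable_cball.
rewrite -(fineK pfin) sumEFin !lee_fin sumr_const card_ord -[_ *+ M]mulr_natl.
set p := fine _ => Mp.
have p0 : 0 <= p by exact: fine_ge0.
have r0 : 0 <= (rho / 3) ^+ n.
  by rewrite exprn_ge0// divr_ge0// ltW//; case/andP: rho01.
by nra.
Qed.

End uniform_sphere.

(** * The expected volume of the random polytope *)

Section random_polytope.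
Context {R : realType} {n N : nat} {d : measure_display} {T : measurableType d}.
Variables (P : probability T R) (X : 'I_N -> {RV P >-> 'rV[R]_n}).
Hypothesis indep : mutually_independent P (fun i => X i : T -> 'rV[R]_n).
Hypothesis unif : forall i, uniform_on_sphere (distribution P (X i)).

Notation V := (lebesgue_rV R n).
Notation B := (@eucl_ball R n).
Let S w := conv_hull (range (fun i => X i w)).
Let on_sphere := [set w | forall i, eucl_norm (X i w) = 1].

Lemma measurable_preX (i : 'I_N) (A : set 'rV[R]_n) : measurable A ->
  measurable (X i @^-1` A).
Proof.
by move=> mA; rewrite -[X in measurable X]setTI; exact: measurable_funP.
Qed.

(** This is the shape of the events in [mutually_independent]. *)
Lemma on_sphereE :
  on_sphere =
  \bigcap_(i in [set` [set: 'I_N]%SET]) (X i @^-1` @eucl_sphere R n).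
Proof.
apply/seteqP; split => [w w1 i _|w w1 i]; first exact: w1.
by apply: w1; rewrite /= inE.
Qed.

Lemma measurable_on_sphere : measurable on_sphere.
Proof.
rewrite on_sphereE; apply: fin_bigcap_measurable => // i _.
apply: measurable_preX; exact: measurable_eucl_sphere.
Qed.

Lemma prob_on_sphere : P on_sphere = 1%E.
Proof.
rewrite on_sphereE indep; last by move=> i; exact: measurable_eucl_sphere.
by apply: big1 => i _; exact: (unif i).1.
Qed.

Lemma prob_off_sphere : P (~` on_sphere) = 0%E.
Proof.
rewrite probability_setC ?prob_on_sphere ?subee//; exact: measurable_on_sphere.
Qed.

(** The function [f] is below the measurable function equal to [b] on
    [on_sphere] and to [+oo] on its complement, which has probability [0]. *)
Lemma expectation_le_as (f : T -> R) (b : R) : 0 <= b ->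
  (forall w, 0 <= f w) -> (forall w, on_sphere w -> f w <= b) ->
  ('E_P[f] <= b%:E)%E.
Proof.
move=> b0 f0 fb; rewrite unlock.
pose g w := (b%:E + (cst +oo \_ (~` on_sphere)) w)%E.
have mC : measurable (~` on_sphere).
  by apply: measurableC; exact: measurable_on_sphere.
apply: (@le_trans _ _ (\int[P]_w g w)%E).
  apply: ge0_le_integral_lower => w; first by rewrite lee_fin.
  rewrite /g patchE; case: ifPn => [_|]; first by rewrite addey// leey.
  by rewrite notin_setE /= => /contrapT w1; rewrite adde0 lee_fin fb.
have mg : measurable_fun setT (cst +oo%E \_ (~` on_sphere) : T -> \bar R).
  by apply/(measurable_restrictT _ mC).1.
have g0 w : (0 <= (cst +oo \_ (~` on_sphere)) w :> \bar R)%E.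
  by apply: erestrict_ge0 => ? _ /=.
rewrite /g ge0_integralD//.
have -> : (\int[P]_w (cst +oo \_ (~` on_sphere)) w = 0)%E.
  rewrite -(integral_mkcond (~` on_sphere)).
  have := integral_cst P mC +oo%E.
  by rewrite [X in _ = (_ * X)%E]prob_off_sphere mule0.
rewrite adde0; have := integral_cst P measurableT b%:E.
by rewrite [X in _ = (_ * X)%E]probability_setT mule1 => ->.
Qed.

(** One point misses the ball with probability [1 - p <= exp (- p)], where
    [p >= (rho / 3) ^ n]; by independence these bounds multiply. *)
Lemma prob_miss_cball (u : 'rV[R]_n) rho : 0 < rho <= 1 -> eucl_norm u = 1 ->
  (P (\bigcap_(i in [set` [set: 'I_N]%SET]) (X i @^-1` (~` cball u rho))) <=
   (expR (- (N%:R * (rho / 3) ^+ n)))%:E)%E.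
Proof.
move=> rho01 u1.
have mB := measurable_cball u rho.
rewrite (indep _ (B := fun=> ~` cball u rho)); last first.
  by move=> _; exact: measurableC.
have miss i :
    (P (X i @^-1` (~` cball u rho)) <= (expR (- (rho / 3) ^+ n))%:E)%E.
  have mhit : measurable (X i @^-1` cball u rho) := measurable_preX i mB.
  rewrite preimage_setC probability_setC//.
  have hit : (((rho / 3) ^+ n)%:E <= P (X i @^-1` cball u rho))%E.
    exact: (uniform_cball_ge (unif i)).
  have pfin : P (X i @^-1` cball u rho) \is a fin_num.
    by apply: fin_num_measure.
  move: hit; rewrite -(fineK pfin) -EFinB !lee_fin => hit.
  by apply: le_trans (expR_ge1Dx _); rewrite lerD2l lerN2.
apply: (@le_trans _ _
  (\prod_(i in [set: 'I_N]%SET) (expR (- (rho / 3) ^+ n))%:E)%E).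
  (* Nonnegativity is carried along: multiplying inequalities needs it. *)
  apply: (big_ind2 (fun x y : \bar R => 0 <= x /\ x <= y)%E _ _ _).2.
  - by rewrite lexx lee01.
  - move=> x1 x2 y1 y2 [x10 x12] [y10 y12]; split; first exact: mule_ge0.
    exact: lee_pmul.
  - by move=> i _; split; [exact: measure_ge0|exact: miss].
by rewrite prodEFin prodr_const cardsT card_ord -expRM_natl mulrN.
Qed.

Lemma expectation_upper (t rho : R) : 0 < t -> 0 < rho ->
  1 - t ^+ 4 <= rho ^+ 2 ->
  ('E_P[fun w => fine (V (S w))] <= (t ^+ n + N%:R * rho ^+ n)%:E * V B)%E.
Proof.
move=> t0 rho0 trho; rewrite -(fineK (@lebesgue_eucl_ball_fin R n)) -EFinM.
apply: expectation_le_as => [|w|w w1].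
- rewrite mulr_ge0 ?fine_ge0 ?measure_ge0//.
  by rewrite addr_ge0 ?mulr_ge0 ?exprn_ge0// ltW.
- exact/fine_ge0/measure_ge0.
have h := lebesgue_conv_hull_le w1 t0 rho0 trho.
rewrite -lee_fin EFinM fineK ?fineK ?lebesgue_eucl_ball_fin//.
rewrite ge0_fin_numE ?measure_ge0// (le_lt_trans h)//.
by rewrite -(fineK (@lebesgue_eucl_ball_fin R n)) -EFinM ltry.
Qed.

Lemma conv_hull_sub_ball w : on_sphere w -> S w `<=` B.
Proof.
move=> w1 x /conv_hull_dot[_ [i _ <-] xX].
have := cauchy_schwarz (X i w) x; rewrite w1 mul1r => cs.
rewrite /eucl_ball/= leNgt; apply/negP => x1.
by have := le_trans xX cs; rewrite -sqr_eucl_norm; nra.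
Qed.

Lemma conv_hull_fin w : on_sphere w -> V (S w) \is a fin_num.
Proof.
move=> w1; rewrite ge0_fin_numE ?measure_ge0//.
apply: le_lt_trans (le_lebesgue_rV (conv_hull_sub_ball w1)) _.
by rewrite -(fineK (@lebesgue_eucl_ball_fin R n)) ltry.
Qed.

Lemma expectation_le_ball : ('E_P[fun w => fine (V (S w))] <= V B)%E.
Proof.
rewrite -(fineK (@lebesgue_eucl_ball_fin R n)).
apply: expectation_le_as => [|w|w w1]; [exact/fine_ge0/measure_ge0..|].
rewrite -lee_fin !fineK ?lebesgue_eucl_ball_fin ?conv_hull_fin//.
exact/le_lebesgue_rV/conv_hull_sub_ball.
Qed.

(** Outside an event of small probability all points are on the sphere and every
    ball of radius [rho] around a point of a net contains one of them; there the
    hull contains the ball of radius [1 - 2 * rho ^ 2].  The failure probability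
    is estimated by a union bound over the net. *)
Lemma expectation_lower (rho : R) : (0 < N)%N -> 0 < rho -> 2 * rho ^+ 2 < 1 ->
  (((1 - 2 * rho ^+ 2) ^+ n *
    (1 - (3 / rho) ^+ n * expR (- (N%:R * (rho / 3) ^+ n))))%:E * V B <=
   'E_P[fun w => fine (V (S w))])%E.
Proof.
move=> N0 rho0 rho2.
have rho01 : 0 < rho <= 1 by rewrite rho0/=; nra.
have [M [v [Mle v1 netv]]] := @sphere_net R n rho rho01.
set r := 1 - 2 * rho ^+ 2.
have r0 : 0 < r by rewrite subr_gt0.
pose miss (i : 'I_M) :=
  \bigcap_(j in [set` [set: 'I_N]%SET]) (X j @^-1` (~` cball (v i) rho)).
have mmiss i : measurable (miss i).
  apply: fin_bigcap_measurable => // j _; apply: measurable_preX.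
  by apply: measurableC; exact: measurable_cball.
pose bad := ~` on_sphere `|` \big[setU/set0]_i miss i.
have mbad1 : measurable (\big[setU/set0]_i miss i) by exact: bigsetU_measurable.
have mC : measurable (~` on_sphere).
  by apply: measurableC; exact: measurable_on_sphere.
have mbad : measurable bad by exact: measurableU.
have Pbad : (P bad <= ((3 / rho) ^+ n * expR (- (N%:R * (rho / 3) ^+ n)))%:E)%E.
  apply: le_trans (measureU2 _ mC mbad1) _.
  rewrite [X in (X + _)%E]prob_off_sphere add0e.
  apply: le_trans (measure_bigsetU_le P mmiss) _.
  apply: (@le_trans _ _ (\sum_(i < M) (expR (- (N%:R * (rho / 3) ^+ n)))%:E)%E).
    by apply: lee_sum => i _; apply: prob_miss_cball => //; exact: v1.
  rewrite sumEFin lee_fin sumr_const card_ord -[_ *+ M]mulr_natl.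
  rewrite ler_wpM2r ?expR_ge0//.
  have -> : (3 / rho) ^+ n = ((rho / 3) ^+ n)^-1.
    by rewrite -exprVn invfM invrK mulrC.
  by rewrite -[leRHS]mul1r ler_pdivlMr// exprn_gt0// divr_gt0.
pose b := r ^+ n * fine (V B).
have b0 : 0 <= b.
  by rewrite mulr_ge0 ?exprn_ge0 ?(ltW r0)// fine_ge0// measure_ge0.
apply: (@le_trans _ _ (b%:E * P (~` bad))%E).
  rewrite probability_setC// -(fineK (@lebesgue_eucl_ball_fin R n)) -EFinM.
  have pfin : P bad \is a fin_num by exact: fin_num_measure.
  move: Pbad; rewrite -(fineK pfin) -EFinB -EFinM !lee_fin => Pbad.
  rewrite /b mulrAC ler_wpM2l// ?lerD2l ?lerN2//.
have -> : (b%:E * P (~` bad) = \int[P]_w (cst b%:E \_ (~` bad)) w)%E.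
  rewrite -integral_mkcond; apply/esym/integral_cst; exact: measurableC.
rewrite unlock; apply: ge0_le_integral_lower => w.
  by apply: erestrict_ge0 => ? _ /=; rewrite lee_fin.
rewrite patchE; case: ifPn => [|_]; last first.
  by rewrite lee_fin fine_ge0// measure_ge0.
move=> /set_mem/= nbad.
have w1 : on_sphere w by apply: contrapT => w1; apply: nbad; left.
rewrite lee_fin -lee_fin /b EFinM.
rewrite !fineK ?lebesgue_eucl_ball_fin ?conv_hull_fin//.
rewrite -(lebesgue_cball 0 r0); apply: le_lebesgue_rV.
apply: (@ball_sub_conv_hull_net _ _ _ M _ v) => //; first exact: ltW.
move=> i iM; apply: contrapT => far; apply: nbad; right.
rewrite -bigcup_seq/=; exists (Ordinal iM); first by rewrite /= mem_index_enum.
by move=> j _ /= Xj; apply: far; exists j.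
Qed.

End random_polytope.
(** * Rates of convergence *)

Section rates.
Context {R : realType}.
Implicit Types (eps : R) (n N : nat).

Lemma expRN_le_inv (x : R) : 0 < x -> expR (- x) <= x^-1.
Proof.
move=> x0; rewrite expRN lef_pV2 ?posrE ?expR_gt0//.
by apply: le_trans (expR_ge1Dx x); rewrite lerDr.
Qed.

Lemma bernoulli_le (x : R) n : 0 <= x <= 1 -> 1 - n%:R * x <= (1 - x) ^+ n.
Proof.
move=> /andP[x0 x1]; elim: n => [|n IHn]; first by rewrite expr0 mul0r subr0.
rewrite exprS -natr1; have := ler_wpM2l (_ : 0 <= 1 - x) IHn.
rewrite subr_ge0 => /(_ x1); apply: le_trans.
have : 0 <= n%:R * (x * x) by rewrite !mulr_ge0.
lra.
Qed.

Lemma ln_nat_le n : ln n%:R <= n%:R :> R.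
Proof.
case: n => [|n]; first by rewrite ln0.
rewrite -natr1 addrC (le_trans (le_ln1Dx _)) ?lerDr//.
by rewrite (lt_le_trans _ (ler0n _ _)).
Qed.

Lemma ln_nat_gt0 n : 0 < ln n%:R :> R -> 0 < n%:R :> R.
Proof. by case: n => [|n]; [rewrite ln0 ?ltxx|rewrite ltr0n]. Qed.

(** Take [t = 1 - n ^ (- c)] and [rho = 2 * n ^ (- c / 2)] with
    [c = 1 - eps / 2].  Then [t ^ n <= exp (- n ^ (eps / 2))], and
    [N * rho ^ n] is at most [n ^ (- eps * n / 4)] up to the factor [2 ^ n],
    which the lower bound on [eps * ln n] absorbs.  Both terms are far smaller
    than stated; [1 / ln n] is a crude common bound for them. *)
Lemma small_N_rate eps n N : 0 < eps < 1 -> 7 <= eps / 4 * ln n%:R ->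
  N%:R <= expR ((1 - eps) * ((n%:R - 1) / 2) * ln n%:R) ->
  exists t rho : R, [/\ 0 < t, 0 < rho, 1 - t ^+ 4 <= rho ^+ 2 &
    t ^+ n + N%:R * rho ^+ n <= (2 / eps + 1) / ln n%:R].
Proof.
move=> /andP[e0 e1] hL hN; set L := ln n%:R in hL hN *.
have L28 : 28 < L by nra.
have L0 : 0 < L by lra.
have n0 : 0 < n%:R :> R by exact: ln_nat_gt0.
have nE : expR L = n%:R by rewrite lnK ?posrE.
have Ln : L <= n%:R := ln_nat_le n.
pose c := 1 - eps / 2.
pose dl := expR (- (c * L)).
have dl0 : 0 < dl by exact: expR_gt0.
have dl1 : dl < 1 by rewrite expR_lt1 oppr_lt0 mulr_gt0// /c; lra.
exists (1 - dl), (2 * expR (- (c / 2 * L))); split.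
- by rewrite subr_gt0.
- by rewrite mulr_gt0// expR_gt0.
- rewrite exprMn -expRM_natl.
  have -> : 2%:R * (- (c / 2 * L)) = - (c * L) by field.
  have := @bernoulli_le dl 4; rewrite (ltW dl0) (ltW dl1) => /(_ isT).
  by rewrite -/dl; lra.
- rewrite [leRHS]mulrDl mul1r; apply: lerD.
    apply: (@le_trans _ _ (expR (- (expR (eps / 2 * L))))).
      apply: (@le_trans _ _ (expR (- dl) ^+ n)).
        by rewrite lerXn2r ?nnegrE ?expR_ge0 ?subr_ge0 ?(ltW dl1)// expR_ge1Dx.
      rewrite -expRM_natl mulrN ler_expR lerN2 -nE -expRD ler_expR /c; lra.
    apply: le_trans (expRN_le_inv (expR_gt0 _)) _.
    rewrite -[2 / eps]invf_div -invfM.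
    rewrite lef_pV2 ?posrE ?expR_gt0 ?mulr_gt0 ?divr_gt0//.
    by apply: le_trans (expR_ge1Dx _); rewrite lerDr.
  apply: (@le_trans _ _ (expR (- L))); last exact: expRN_le_inv.
  rewrite exprMn -expRM_natl.
  have ln2 : ln 2 <= 1 :> R.
    by have := @le_ln1Dx R 1; rewrite -[1 + 1]/(2 : R); apply; lra.
  have -> : (2 : R) ^+ n = expR (n%:R * ln 2) by rewrite expRM_natl lnK ?posrE.
  rewrite -expRD; apply: le_trans (ler_wpM2r (expR_ge0 _) hN) _.
  rewrite -expRD ler_expR.
  have nL : 28 * n%:R <= eps * (n%:R * L).
    have := ler_wpM2l (ltW n0) hL; lra.
  have nln2 : n%:R * ln 2 <= n%:R :> R by rewrite ger_pMr.
  have : 0 <= (1 - eps) * L by rewrite mulr_ge0 ?subr_ge0 ?ltW.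
  by rewrite /c; lra.
Qed.

(** Take [rho = n ^ (- c / 2)] with [c = 1 + eps / 2].  Bernoulli's inequality
    gives [(1 - 2 * rho ^ 2) ^ n >= 1 - 2 * n ^ (- eps / 2)].  Writing
    [(3 / rho) ^ n = exp a], the other factor is at least
    [1 - exp (a - N * exp (- a))], where [a] is at most quadratic in [n] whereas
    [N * exp (- a) >= exp (4 * n)]. *)
Lemma large_N_rate eps n N : 0 < eps < 1 -> 7 <= eps / 4 * ln n%:R ->
  expR ((1 + eps) * ((n%:R - 1) / 2) * ln n%:R) <= N%:R ->
  exists rho : R, [/\ 0 < rho, 2 * rho ^+ 2 < 1 &
    1 - (4 / eps + 1) / ln n%:R <=
    (1 - 2 * rho ^+ 2) ^+ n *
      (1 - (3 / rho) ^+ n * expR (- (N%:R * (rho / 3) ^+ n)))].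
Proof.
move=> /andP[e0 e1] hL hN; set L := ln n%:R in hL hN *.
have L28 : 28 < L by nra.
have L0 : 0 < L by lra.
have n0 : 0 < n%:R :> R by exact: ln_nat_gt0.
have nE : expR L = n%:R by rewrite lnK ?posrE.
have Ln : L <= n%:R := ln_nat_le n.
pose c := 1 + eps / 2.
pose rho := expR (- (c / 2 * L)).
have rho0 : 0 < rho by exact: expR_gt0.
have rhoE : rho ^+ 2 = expR (- (c * L)).
  by rewrite -expRM_natl; congr expR; field.
have rho2 : 2 * rho ^+ 2 < 1.
  have cL : 0 < c * L by rewrite mulr_gt0// /c; lra.
  rewrite rhoE; apply: le_lt_trans (ler_wpM2l _ (expRN_le_inv cL)) _ => //.
  rewrite ltr_pdivrMr// /c; nra.
exists rho; split => //.
pose a := n%:R * (ln 3 + c / 2 * L).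
have aE : (3 / rho) ^+ n = expR a.
  rewrite /a expRM_natl expRD lnK ?posrE// /rho expRN invrK//.
have aVE : (rho / 3) ^+ n = expR (- a).
  by rewrite expRN -aE -exprVn invfM invrK mulrC.
have ln3 : ln 3 <= 2 :> R.
  by have := @le_ln1Dx R 2; rewrite (_ : 1 + 2 = 3); [apply; lra|ring].
have nL : 28 * n%:R <= eps * (n%:R * L).
  have := ler_wpM2l (ltW n0) hL; lra.
have nln3 : n%:R * ln 3 <= n%:R * 2 :> R by rewrite ler_pM2l.
have an : a + n%:R <= (1 + 2 * n%:R) ^+ 2.
  have : n%:R * L <= n%:R * n%:R by rewrite ler_pM2l.
  have : 0 <= n%:R * L by rewrite mulr_ge0 ?ltW.
  by rewrite /a /c; nra.
have miss : (3 / rho) ^+ n * expR (- (N%:R * (rho / 3) ^+ n)) <= L^-1.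
  apply: (@le_trans _ _ (expR (- L))); last exact: expRN_le_inv.
  rewrite aE aVE -expRD ler_expR.
  suff : a + n%:R <= N%:R * expR (- a) by lra.
  apply: le_trans an _; apply: (@le_trans _ _ (expR (4 * n%:R))).
    rewrite (_ : 4 * n%:R = 2%:R * (2 * n%:R)); last by ring.
    rewrite expRM_natl; apply: lerXn2r; rewrite ?nnegrE ?expR_ge0//.
    exact: expR_ge1Dx.
  apply: le_trans (ler_wpM2r (expR_ge0 _) hN).
  rewrite -expRD ler_expR /a /c.
  have : eps * L <= L by rewrite ger_pMl// ltW.
  lra.
have ball : 1 - (4 / eps) / L <= (1 - 2 * rho ^+ 2) ^+ n.
  apply: le_trans (bernoulli_le _ _); last by rewrite mulr_ge0 ?exprn_ge0 ?ltW.
  rewrite lerD2l lerN2 rhoE mulrCA -nE -expRD.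
  rewrite (_ : L + - (c * L) = - (eps / 2 * L)); last by rewrite /c; field.
  have eL : 0 < eps / 2 * L by rewrite mulr_gt0// divr_gt0.
  apply: le_trans (ler_wpM2l _ (expRN_le_inv eL)) _ => //.
  rewrite (_ : 2 / (eps / 2 * L) = 4 / eps / L)//; field.
  by rewrite !gt_eqF.
have ball1 : (1 - 2 * rho ^+ 2) ^+ n <= 1.
  by rewrite exprn_ile1// ?gerBl ?mulr_ge0 ?exprn_ge0 ?subr_ge0// ltW.
have ball0 : 0 <= (1 - 2 * rho ^+ 2) ^+ n.
  by rewrite exprn_ge0// subr_ge0 ltW.
set q := (1 - 2 * rho ^+ 2) ^+ n in ball ball1 ball0 *.
set m := (3 / rho) ^+ n * _ in miss *.
have m0 : 0 <= m by rewrite mulr_ge0 ?expR_ge0// exprn_ge0// divr_ge0// ltW.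
rewrite [(_ + 1) / L]mulrDl mul1r mulrBr mulr1.
have : q * m <= m by rewrite ler_piMl.
lra.
Qed.

Lemma ln_nat_near (K : R) : \forall n \near \oo, K <= ln n%:R.
Proof.
near=> n; rewrite -(expRK K) ler_ln ?posrE ?expR_gt0//.
  by near: n; exact: nbhs_infty_ger.
rewrite ltr0n; near: n; exact: nbhs_infty_gt.
Unshelve. all: by end_near. Qed.

Lemma cvg_div_ln (K : R) : K / ln n%:R @[n --> \oo] --> 0.
Proof.
rewrite -(mulr0 K); apply: cvgMr; apply/gtr0_cvgV0; last first.
  by apply/cvgryPge => A; exact: ln_nat_near.
by near=> n; apply: (@lt_le_trans _ _ 1) => //; near: n; exact: ln_nat_near.
Unshelve. all: by end_near. Qed.

End rates.
(** * The threshold *)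

Lemma lee_div_fin (R : realType) (V x : \bar R) (c : R) :
  (0 < V)%E -> V \is a fin_num ->
  ((x / V <= c%:E) = (x <= c%:E * V))%E * ((c%:E <= x / V) = (c%:E * V <= x))%E.
Proof.
move=> V0 Vfin; move: V0; rewrite -(fineK Vfin) lte_fin => v0.
by rewrite inver gt_eqF// lee_pdivrMr// lee_pdivlMr.
Qed.

Theorem corollary1p3 (R : realType) (eps : R) (N : nat -> nat)
    (d : nat -> measure_display) (T : forall n : nat, measurableType (d n))
    (P : forall n : nat, probability (T n) R)
    (X : forall n : nat, 'I_(N n) -> {RV (P n) >-> 'rV[R]_n}) :
  0 < eps < 1 ->
  (forall n : nat, (0 < n)%N -> (n < N n)%N) ->
  (forall n : nat, (0 < n)%N ->
     mutually_independent (P n) (fun i => X n i : T n -> 'rV[R]_n)) ->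
  (forall n : nat, (0 < n)%N -> forall i : 'I_(N n),
     uniform_on_sphere (distribution (P n) (X n i))) ->
  let S (n : nat) (w : T n) : set 'rV[R]_n :=
    conv_hull (range (fun i => X n i w)) in
  let ratio (n : nat) : \bar R :=
    ('E_(P n)[fun w => fine (lebesgue_rV R n (S n w))]
       / lebesgue_rV R n (@eucl_ball R n))%E in
  ((\forall n \near \oo,
      (N n)%:R <= expR ((1 - eps) * ((n%:R - 1) / 2) * ln n%:R)) ->
    ratio n @[n --> \oo] --> 0%E) /\
  ((\forall n \near \oo,
      (N n)%:R >= expR ((1 + eps) * ((n%:R - 1) / 2) * ln n%:R)) ->
    ratio n @[n --> \oo] --> 1%E).
Proof.
move=> eps01 ltnN indep unif S ratio; have [eps0 _] := andP eps01.
have ratioE n c := lee_div_fin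
  ('E_(P n)[fun w => fine (lebesgue_rV R n (S n w))]) c
  (lebesgue_eucl_ball_gt0 n) (lebesgue_eucl_ball_fin n).
have large_ln : \forall n \near \oo, 7 <= eps / 4 * ln n%:R.
  near=> n; rewrite -ler_pdivrMl ?divr_gt0//; near: n; exact: ln_nat_near.
have cvg_rate (l K : R) : (l + K / ln n%:R)%:E @[n --> \oo] --> l%:E.
  apply: cvg_EFin; first by near=> n.
  rewrite -[X in _ --> X]addr0; apply: cvgD; [exact: cvg_cst|exact: cvg_div_ln].
split => NE.
- have cvg0 : (cst 0%E : nat -> \bar R) n @[n --> \oo] --> 0%E.
    exact: cvg_cst.
  apply: (squeeze_cvge _ cvg0 (cvg_rate 0 (2 / eps + 1))).
  near=> n; have n0 : (0 < n)%N by near: n; exact: nbhs_infty_gt.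
  have ln_n : 7 <= eps / 4 * ln n%:R by near: n.
  have NEn : (N n)%:R <= expR ((1 - eps) * ((n%:R - 1) / 2) * ln n%:R).
    by near: n.
  have [t [rho [t0 rho0 trho rate]]] :=
    small_N_rate eps01 ln_n NEn.
  rewrite /= add0r; apply/andP; split.
    rewrite (ratioE n 0).2 mul0e unlock; apply: integral_ge0 => w _.
    by rewrite lee_fin fine_ge0// measure_ge0.
  rewrite (ratioE n _).1.
  apply: le_trans (expectation_upper (indep _ n0) (unif _ n0) t0 rho0 trho) _.
  by rewrite lee_pmul2r ?lebesgue_eucl_ball_fin ?lebesgue_eucl_ball_gt0.
- have cvg1 : (cst 1%E : nat -> \bar R) n @[n --> \oo] --> 1%E.
    exact: cvg_cst.
  apply: (squeeze_cvge _ (cvg_rate 1 (- (4 / eps + 1))) cvg1).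
  near=> n; have n0 : (0 < n)%N by near: n; exact: nbhs_infty_gt.
  have N0 : (0 < N n)%N by exact: leq_ltn_trans (ltnN _ n0).
  have ln_n : 7 <= eps / 4 * ln n%:R by near: n.
  have NEn : (N n)%:R >= expR ((1 + eps) * ((n%:R - 1) / 2) * ln n%:R).
    by near: n.
  have [rho [rho0 rho2 rate]] :=
    large_N_rate eps01 ln_n NEn.
  rewrite /= mulNr; apply/andP; split.
    rewrite (ratioE n _).2.
    apply: le_trans (expectation_lower (indep _ n0) (unif _ n0) N0 rho0 rho2).
    by rewrite lee_pmul2r ?lebesgue_eucl_ball_fin ?lebesgue_eucl_ball_gt0.
  rewrite (ratioE n 1).1 mul1e.
  exact: expectation_le_ball (indep _ n0) (unif _ n0).
Unshelve. all: by end_near. Qed.
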